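(* Let $(\mathcal N,J,g)$ be a Kähler manifold whose Kähler form satisfies $\omega=d\tau$ for a globally defined 1-form $\tau$, and let $\mathcal M=\mathbb R\times\mathcal N$ be equipped with the Sasakian lift structure $(\phi,\xi,\eta,g^L)$ described in the context. Then $\mathcal M$ with $(\phi,\xi,\eta,g^L)$ is a Sasakian manifold.
   Context: Conventions: $2\,d\theta(X,Y)=X\theta(Y)-Y\theta(X)-\theta([X,Y])$ for a 1-form $\theta$. On a Kähler manifold $(\mathcal N,J,g)$, $\dim\mathcal N=2n$, the Kähler form is $\omega(X,Y)=g(X,JY)$. Lift structure: $\mathcal M=\mathbb R\times\mathcal N$ with projections $\pi_1,\pi_2$ and coordinate $t$ on $\mathbb R$; $\xi=\partial_t$, $\eta=dt+\pi_2^*\tau$. A vector field $X$ on $\mathcal N$ is lifted to $X^L=X-(\tau(X)\circ\pi_2)\,\xi$ on $\mathcal M$ (with $X$ viewed as a field on the product tangent to $\mathcal N$). The $(1,1)$-tensor $\phi$ and metric $g^L$ are determined by $\phi X^L=(JX)^L$, $\phi\xi=0$, $g^L=\eta\otimes\eta+\pi_2^*g$. An almost contact metric structure $(\phi,\xi,\eta,g)$ satisfies $\phi^2X=-X+\eta(X)\xi$, $\eta(\xi)=1$, $g(\phi X,\phi Y)=g(X,Y)-\eta(X)\eta(Y)$; its fundamental form is $\Phi(X,Y)=g(X,\phi Y)$. It is contact metric if $d\eta=\Phi$, and normal if $N_\phi+2d\eta\otimes\xi=0$, where $N_\phi(X,Y)=\phi^2[X,Y]+[\phi X,\phi Y]-\phi([\phi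 X,Y]+[X,\phi Y])$. A Sasakian manifold is a contact metric and normal one (equivalently $(\nabla_X\phi)Y=g(X,Y)\xi-\eta(Y)X$). *)

(* Defs.v *)
From HB Require Import structures.
From mathcomp Require Import all_boot all_order all_algebra.
From mathcomp Require Import all_classical all_reals all_analysis.

Set Implicit Arguments.
Unset Strict Implicit.
Unset Printing Implicit Defensive.

Import Order.TTheory GRing.Theory Num.Theory.
Import numFieldNormedType.Exports.

Local Open Scope classical_set_scope.
Local Open Scope ring_scope.

Fixpoint iter_derive (R : realType) (V W : normedModType R)
    (vs : seq V) (f : V -> W) : V -> W :=
  if vs is v :: vs' then iter_derive vs' ('D_v f) else f.

(* C^oo on an open set: every iterated directional derivative of f, f itself
   included, is Frechet differentiable at every point of U. *)
Definition smooth_on (R : realType) (V W : normedModType R)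
    (U : set V) (f : V -> W) : Prop :=
  forall (vs : seq V) (x : V), U x -> differentiable (iter_derive vs f) x.

Section smooth_on_lemmas.
Context {R : realType}.

Lemma near_eq_differentiable (V W : normedModType R) (f g : V -> W) (x : V) :
  (\near x, f x = g x) -> differentiable f x -> differentiable g x.
Proof.
move=> fg df.
have fgx : f x = g x by exact: nbhs_singleton fg.
have e : g \o shift x = cst (g x) + 'd f x +o_ 0 id.
  apply/eqaddoP => _/posnumP[eps].
  have /eqaddoP/(_ _ [gt0 of eps%:num])  := diff_locally df.
  have : \forall h \near (0 : V), f (h + x) = g (h + x).
    by move: fg; rewrite (near_shift 0 x) /= => fg; near do
      (rewrite -[_ + x]/((shift x) _)); move: fg; apply: filterS => h /=;
      rewrite subr0.
  by apply: filterS2 => h /= fgh; rewrite /= !fctE/= fgh fgx.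
have dE : 'd g x = 'd f x :> (V -> W).
  by apply: diff_unique => //; exact: diff_continuous.
by apply/diff_locallyP; rewrite dE; split => //; exact: diff_continuous.
Unshelve. all: by end_near. Qed.

Lemma eq_on_iter_derive (V W : normedModType R) (U : set V) (vs : seq V)
    (f g : V -> W) :
  open U -> (forall x, U x -> f x = g x) ->
  forall x, U x -> iter_derive vs f x = iter_derive vs g x.
Proof.
move=> oU; elim: vs f g => [//|v vs ih] f g fg x Ux /=.
apply: ih => // y Uy; apply: near_eq_derive.
by move: (open_nbhs_nbhs (conj oU Uy)); apply: filterS => z /fg.
Qed.

Lemma eq_on_smooth_on (V W : normedModType R) (U : set V) (f g : V -> W) :
  open U -> (forall x, U x -> f x = g x) -> smooth_on U f -> smooth_on U g.
Proof.
move=> oU fg sf vs x Ux; apply: near_eq_differentiable (sf vs x Ux).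
move: (open_nbhs_nbhs (conj oU Ux)); apply: filterS => z Uz.
exact: eq_on_iter_derive Uz.
Qed.

Lemma smooth_on_derive (V W : normedModType R) (U : set V) (f : V -> W)
    (v : V) :
  smooth_on U f -> smooth_on U ('D_v f).
Proof. by move=> sf vs; exact: (sf (v :: vs)). Qed.

Lemma linear_continuous_smooth_on (V W : normedModType R) (U : set V)
    (f : {linear V -> W}) : continuous f -> smooth_on U f.
Proof.
move=> cf; case=> [|v vs] x _ /=; first exact: linear_differentiable.
have -> : 'D_v f = cst (f v).
  apply/funext => y; rewrite deriveE; last exact: linear_differentiable.
  by rewrite diff_lin.
elim: vs (f v) => [|u vs ih] w /=; first exact: differentiable_cst.
have -> : 'D_u (cst w : V -> W) = cst 0 by apply/funext => y; exact: derive_cst.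
exact: ih.
Qed.

Section row_pair.
Context {n1 n2 : nat}.

Definition row_pair (uv : 'rV[R]_n1 * 'rV[R]_n2) : 'rV[R]_(n1 + n2) :=
  row_mx uv.1 uv.2.

Fact row_pair_is_linear : linear row_pair.
Proof. by move=> a u v; rewrite /row_pair /= scale_row_mx add_row_mx. Qed.

HB.instance Definition _ :=
  GRing.isLinear.Build R _ _ _ row_pair row_pair_is_linear.

Lemma continuous_row_pair : continuous row_pair.
Proof.
move=> u A /nbhs_ballP[e /= e0 eA].
apply/nbhs_ballP; exists e => //= v [[_ uv1] [_ uv2]].
apply: eA; split => // i j.
by rewrite !mxE; case: (fintype.split j) => k; [exact: uv1 | exact: uv2].
Qed.

End row_pair.

Lemma smooth_on_row_mx m1 m2 n1 n2 (A : set 'rV[R]_m1) (B : set 'rV[R]_m2)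
    (f : 'rV[R]_m1 -> 'rV[R]_n1) (g : 'rV[R]_m2 -> 'rV[R]_n2) :
  open A -> open B -> smooth_on A f -> smooth_on B g ->
  smooth_on [set x : 'rV[R]_(m1 + m2) | A (lsubmx x) /\ B (rsubmx x)]
    (fun x => row_mx (f (lsubmx x)) (g (rsubmx x))).
Proof.
move=> oA oB sf sg vs; move: f g sf sg.
set C := [set x | _].
have oC : open C.
  apply: openI.
    by apply: (open_comp _ oA) => x _; exact: continuous_lsubmx.
  by apply: (open_comp _ oB) => x _; exact: continuous_rsubmx.
pose F (f : 'rV[R]_m1 -> 'rV[R]_n1) (g : 'rV[R]_m2 -> 'rV[R]_n2) :=
  (@row_pair n1 n2) \o
    (fun x : 'rV[R]_(m1 + m2) => ((f \o lsubmx) x, (g \o rsubmx) x)).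
have dF f g x : differentiable f (lsubmx x) -> differentiable g (rsubmx x) ->
    is_diff x (F f g)
      ((@row_pair n1 n2) \o (fun v : 'rV[R]_(m1 + m2) =>
        ('d f (lsubmx x) (lsubmx v), 'd g (rsubmx x) (rsubmx v)))).
  move=> df dg.
  have dfl : is_diff x (f \o lsubmx) ('d f (lsubmx x) \o lsubmx).
    apply: is_diff_comp; last exact: differentiableP.
    apply: DiffDef; first exact: differentiable_lsubmx.
    by rewrite diff_lin //; exact: continuous_lsubmx.
  have dgr : is_diff x (g \o rsubmx) ('d g (rsubmx x) \o rsubmx).
    apply: is_diff_comp; last exact: differentiableP.
    apply: DiffDef; first exact: differentiable_rsubmx.
    by rewrite diff_lin //; exact: continuous_rsubmx.
  apply: is_diff_comp; apply: DiffDef.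
    exact/linear_differentiable/continuous_row_pair.
  by rewrite diff_lin //; exact: continuous_row_pair.
elim: vs => [|v vs ih] f g sf sg x [Ax Bx].
  by have [] := dF f g x (sf [::] _ Ax) (sg [::] _ Bx).
have := ih _ _ (smooth_on_derive (lsubmx v) sf)
               (smooth_on_derive (rsubmx v) sg) x (conj Ax Bx).
apply: near_eq_differentiable.
move: (open_nbhs_nbhs (conj oC (conj Ax Bx))); apply: filterS => y Cy /=.
apply: (eq_on_iter_derive (U := C)) => // z [Az Bz].
have [dz dzE] := dF f g z (sf [::] _ Az) (sg [::] _ Bz).
rewrite -[RHS]/('D_v (F f g) z) [RHS]deriveE // dzE /row_pair /=.
by rewrite !deriveE //; [exact: (sg [::]) | exact: (sf [::])].
Qed.

End smooth_on_lemmas.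

(* A Hausdorff second countable space with a smooth atlas.  The chart i is the
   homeomorphism [chart i] from the open set [mdom i] onto the open subset
   [mcod i] of R^m, with inverse [chart_inv i]; both are total functions whose
   values outside [mdom i], [mcod i] are irrelevant.  [chart_at] selects a
   chart around each point; it is only used to represent tangent vectors. *)
Record manifold (R : realType) (m : nat) := Manifold {
  mspace :> topologicalType ;
  mhausdorff : hausdorff_space mspace ;
  msecond_countable : @second_countable mspace ;
  mindex : Type ;
  mdom : mindex -> set mspace ;
  mcod : mindex -> set 'rV[R]_m ;
  chart : mindex -> mspace -> 'rV[R]_m ;
  chart_inv : mindex -> 'rV[R]_m -> mspace ;
  mdom_open : forall i, open (mdom i) ;
  mcod_open : forall i, open (mcod i) ;
  chart_cod : forall i p, mdom i p -> mcod i (chart i p) ;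
  chart_inv_dom : forall i x, mcod i x -> mdom i (chart_inv i x) ;
  chartK : forall i p, mdom i p -> chart_inv i (chart i p) = p ;
  chart_invK : forall i x, mcod i x -> chart i (chart_inv i x) = x ;
  chart_continuous : forall i p, mdom i p -> {for p, continuous (chart i)} ;
  chart_inv_continuous :
    forall i x, mcod i x -> {for x, continuous (chart_inv i)} ;
  chart_transition : forall i j,
    smooth_on [set x | mcod i x /\ mdom j (chart_inv i x)]
              (chart j \o chart_inv i) ;
  chart_at : mspace -> mindex ;
  chart_at_dom : forall p, mdom (chart_at p) p }.

Section real_line.
Variable R : realType.

Lemma second_countable_R : @second_countable R.
Proof.
exists [set ball (ratr qr.1 : R) (ratr qr.2) | qr in [set: rat * rat]].
  apply: sub_countable (card_image_le _ _) _; exact: countableP.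
split => [_ [[q r] _ <-]|x A]; first exact: ball_open.
rewrite nbhsE => -[B [oB Bx] BA].
have [q [r /= [/set_mem qrx qrB]]] := open_subball_rat oB (mem_set Bx).
exists (ball (ratr q : R) (ratr r)); last exact: subset_trans BA.
by split => //; exists (q, r).
Qed.

Lemma smooth_on_real_line_transition :
  smooth_on [set x : 'rV[R]_1 | setT x /\ [set: R] (x 0 0)]
    ((fun t : R => const_mx t : 'rV[R]_1) \o (fun x : 'rV[R]_1 => x 0 0)).
Proof.
have -> : (fun t : R => const_mx t : 'rV[R]_1) \o (fun x : 'rV[R]_1 => x 0 0)
   = idfun.
  by apply/funext => x; apply/rowP => i /=; rewrite mxE ord1.
by apply: linear_continuous_smooth_on => x.
Qed.

Lemma continuous_const_rV1 : continuous (fun t : R => const_mx t : 'rV[R]_1).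
Proof.
move=> t A /nbhs_ballP[e /= e0 eA].
apply/nbhs_ballP; exists e => //= u tu; apply: eA; split => // i j.
by rewrite !mxE.
Qed.

Definition real_line : manifold R 1.
Proof.
refine (@Manifold R 1 R (@Rhausdorff R) second_countable_R unit
  (fun _ => setT) (fun _ => setT) (fun _ t => const_mx t) (fun _ x => x 0 0)
  _ _ _ _ _ _ _ _ _ (fun _ => tt) _) => //=.
- by move=> _; exact: openT.
- by move=> _; exact: openT.
- by move=> _ t _; rewrite mxE.
- by move=> _ x _; apply/rowP => i; rewrite mxE ord1.
- by move=> _ t _; exact: continuous_const_rV1.
- by move=> _ x _; exact: coord_continuous.
- by move=> _ _; exact: smooth_on_real_line_transition.
Defined.

End real_line.

Section product.
Context {R : realType} {m1 m2 : nat}.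
Variables (M1 : manifold R m1) (M2 : manifold R m2).

Lemma hausdorff_prod (T1 T2 : topologicalType) :
  hausdorff_space T1 -> hausdorff_space T2 -> hausdorff_space (T1 * T2)%type.
Proof.
move=> h1 h2 [x1 x2] [y1 y2] xy; congr pair.
  apply: h1 => A B Ax By.
  have [] := xy (A `*` setT) (B `*` setT).
  - by exists (A, setT) => //=; split => //; exact: filterT.
  - by exists (B, setT) => //=; split => //; exact: filterT.
  by move=> [z1 z2] [[Az _] [Bz _]]; exists z1.
apply: h2 => A B Ax By.
have [] := xy (setT `*` A) (setT `*` B).
- by exists (setT, A) => //=; split => //; exact: filterT.
- by exists (setT, B) => //=; split => //; exact: filterT.
by move=> [z1 z2] [[_ Az] [_ Bz]]; exists z2.
Qed.

Lemma openX (T1 T2 : topologicalType) (A : set T1) (B : set T2) :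
  open A -> open B -> open (A `*` B).
Proof.
move=> oA oB; rewrite openE => -[x y] [/= Ax By].
by exists (A, B) => //; split; apply: open_nbhs_nbhs.
Qed.

Lemma second_countable_prod (T1 T2 : topologicalType) :
  @second_countable T1 -> @second_countable T2 ->
  @second_countable (T1 * T2)%type.
Proof.
move=> [B1 cB1 [oB1 nB1]] [B2 cB2 [oB2 nB2]].
exists [set AB.1 `*` AB.2 | AB in B1 `*` B2].
  by apply: sub_countable (card_image_le _ _) _; exact: countableX.
split=> [_ [[A B] [/= B1A B2B] <-]|[x1 x2] A [[A1 A2] /= [xA1 xA2] A12]].
  exact: openX (oB1 _ B1A) (oB2 _ B2B).
have [U1 [BU1 Ux1] UA1] := nB1 _ _ xA1.
have [U2 [BU2 Ux2] UA2] := nB2 _ _ xA2.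
exists (U1 `*` U2); first by split => //; exists (U1, U2).
by move=> [z1 z2] [/= Uz1 Uz2]; apply: A12; split; [exact: UA1|exact: UA2].
Qed.

Lemma open_transition_dom m (M : manifold R m) (i j : mindex M) :
  open [set x | mcod i x /\ mdom j (chart_inv i x)].
Proof.
rewrite openE => x [ix jx]; rewrite /interior.
apply: (@filterI _ (nbhs x)).
  by apply: open_nbhs_nbhs; split => //; exact: mcod_open.
apply: (chart_inv_continuous ix); apply: open_nbhs_nbhs.
by split => //; exact: mdom_open.
Qed.

Definition prod_cod (i : mindex M1 * mindex M2) : set 'rV[R]_(m1 + m2) :=
  [set x | mcod i.1 (lsubmx x) /\ mcod i.2 (rsubmx x)].
Definition prod_chart (i : mindex M1 * mindex M2) (p : M1 * M2) : 'rV[R]_(m1 + m2) :=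
  row_mx (chart i.1 p.1) (chart i.2 p.2).
Definition prod_chart_inv (i : mindex M1 * mindex M2) (x : 'rV[R]_(m1 + m2)) : M1 * M2 :=
  (chart_inv i.1 (lsubmx x), chart_inv i.2 (rsubmx x)).

(* The product manifold; in its charts the first m1 coordinates come from M1
   and the last m2 from M2. *)
Definition manifold_prod : manifold R (m1 + m2).
Proof.
refine (@Manifold R (m1 + m2) (M1 * M2)%type
  (hausdorff_prod (@mhausdorff _ _ M1) (@mhausdorff _ _ M2))
  (second_countable_prod (@msecond_countable _ _ M1) (@msecond_countable _ _ M2))
  (mindex M1 * mindex M2)%type
  (fun i => mdom i.1 `*` mdom i.2) prod_cod prod_chart prod_chart_inv
  _ _ _ _ _ _ _ _ _ (fun p => (chart_at p.1, chart_at p.2)) _).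
- by move=> [i1 i2]; apply: openX; exact: mdom_open.
- move=> [i1 i2]; apply: openI.
    apply: (@open_comp _ _ lsubmx (mcod i1)); last exact: mcod_open.
    by move=> x _; exact: continuous_lsubmx.
  apply: (@open_comp _ _ rsubmx (mcod i2)); last exact: mcod_open.
  by move=> x _; exact: continuous_rsubmx.
- move=> [i1 i2] [p1 p2] [/= d1 d2]; rewrite /prod_cod /prod_chart /= row_mxKl row_mxKr.
  by split; exact: chart_cod.
- by move=> [i1 i2] x [/= d1 d2]; split; exact: chart_inv_dom.
- move=> [i1 i2] [p1 p2] [/= d1 d2]; rewrite /prod_chart_inv /prod_chart /= row_mxKl row_mxKr.
  by rewrite !chartK.
- move=> [i1 i2] x [/= d1 d2]; rewrite /prod_chart_inv /prod_chart /= !chart_invK //.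
  exact: hsubmxK.
- move=> [i1 i2] [p1 p2] [/= d1 d2].
  apply: (continuous_comp (f := fun p => (chart i1 p.1, chart i2 p.2))
            (g := @row_pair R m1 m2)); last exact: continuous_row_pair.
  have c1 : {for (p1, p2), continuous (chart i1 \o fst)}.
    by apply: continuous_comp; [exact: cvg_fst|exact: chart_continuous].
  have c2 : {for (p1, p2), continuous (chart i2 \o snd)}.
    by apply: continuous_comp; [exact: cvg_snd|exact: chart_continuous].
  exact: cvg_pair c1 c2.
- move=> [i1 i2] x [/= d1 d2].
  have c1 : {for x, continuous (chart_inv i1 \o lsubmx)}.
    apply: continuous_comp; first exact: continuous_lsubmx.
    exact: chart_inv_continuous.
  have c2 : {for x, continuous (chart_inv i2 \o rsubmx)}.
    apply: continuous_comp; first exact: continuous_rsubmx.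
    exact: chart_inv_continuous.
  exact: cvg_pair c1 c2.
- move=> [i1 i2] [j1 j2].
  have h := smooth_on_row_mx (@open_transition_dom _ M1 i1 j1)
    (@open_transition_dom _ M2 i2 j2) (@chart_transition _ _ M1 i1 j1)
    (@chart_transition _ _ M2 i2 j2).
  move=> vs x [[c1 c2] [d1 d2]].
  exact: (h vs x (conj (conj c1 d1) (conj c2 d2))).
- by move=> [p1 p2]; split; exact: chart_at_dom.
Defined.

End product.

Section calculus.
Context {R : realType} {m : nat}.
Implicit Type M : manifold R m.

(* The tangent space at p is R^m: a tangent vector is recorded by its
   components in the chart [chart_at p].  Since p |-> chart_at p is not
   continuous, the smoothness of a field is read off from its components in a
   fixed chart, see [chart_vec] and [chart_field]. *)
Definition vfield M := M -> 'rV[R]_m.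
Definition form1 M := M -> 'rV[R]_m -> R.
Definition form2 M := M -> 'rV[R]_m -> 'rV[R]_m -> R.
Definition tensor11 M := M -> 'rV[R]_m -> 'rV[R]_m.

Definition chart_vec M (i : mindex M) (p : M) (v : 'rV[R]_m) : 'rV[R]_m :=
  'd (chart i \o chart_inv (chart_at p)) (chart (chart_at p) p) v.

Definition chart_field M (i : mindex M) (X : vfield M) : 'rV[R]_m -> 'rV[R]_m :=
  fun x => chart_vec i (chart_inv i x) (X (chart_inv i x)).

Definition smooth_fun M (U : set M) (f : M -> R) : Prop :=
  forall i, smooth_on [set x | mcod i x /\ U (chart_inv i x)]
                      (f \o chart_inv i).

Definition smooth_vfield M (U : set M) (X : vfield M) : Prop :=
  forall i, smooth_on [set x | mcod i x /\ U (chart_inv i x)] (chart_field i X).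

(* df_p(v), i.e. the derivative v(f) *)
Definition dfun M (f : M -> R) (p : M) (v : 'rV[R]_m) : R :=
  'd (f \o chart_inv (chart_at p)) (chart (chart_at p) p) v.

(* [X, Y], computed in the chart [chart_at p] as DY(X) - DX(Y); the components
   of X and Y in that chart at the point p itself are X p and Y p. *)
Definition bracket M (X Y : vfield M) : vfield M := fun p =>
  let i := chart_at p in
  'd (chart_field i Y) (chart i p) (X p) -
  'd (chart_field i X) (chart i p) (Y p).

(* A tensor field is a family of (multi)linear maps on the tangent spaces that
   turns smooth vector fields, given on any open set, into a smooth object. *)
Definition is_form1 M (theta : form1 M) : Prop :=
  (forall p, scalar (theta p)) /\
  (forall U X, open U -> smooth_vfield U X ->
     smooth_fun U (fun p => theta p (X p))).

Definition is_tensor02 M (b : form2 M) : Prop :=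
  [/\ forall p v, scalar (b p v),
      forall p w, scalar (fun v => b p v w)
    & forall U X Y, open U -> smooth_vfield U X -> smooth_vfield U Y ->
        smooth_fun U (fun p => b p (X p) (Y p))].

Definition is_tensor11 M (A : tensor11 M) : Prop :=
  (forall p, linear (A p)) /\
  (forall U X, open U -> smooth_vfield U X ->
     smooth_vfield U (fun p => A p (X p))).

Definition ap M (A : tensor11 M) (X : vfield M) : vfield M := fun p => A p (X p).

(* with the factor 1/2: 2 dtheta(X, Y) = X theta(Y) - Y theta(X) - theta([X, Y]) *)
Definition ext_d1 M (theta : form1 M) (X Y : vfield M) (p : M) : R :=
  2^-1 * (dfun (fun q => theta q (Y q)) p (X p)
          - dfun (fun q => theta q (X q)) p (Y p)
          - theta p (bracket X Y p)).

(* As for ext_d1, the factor is 1/(k+1): 3 dOmega(X, Y, Z) is the cyclic sum of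
   X Omega(Y, Z) - Omega([X, Y], Z) *)
Definition ext_d2 M (Omega : form2 M) (X Y Z : vfield M) (p : M) : R :=
  3^-1 * (dfun (fun q => Omega q (Y q) (Z q)) p (X p)
          + dfun (fun q => Omega q (Z q) (X q)) p (Y p)
          + dfun (fun q => Omega q (X q) (Y q)) p (Z p)
          - Omega p (bracket X Y p) (Z p)
          - Omega p (bracket Y Z p) (X p)
          - Omega p (bracket Z X p) (Y p)).

Definition nijenhuis M (A : tensor11 M) (X Y : vfield M) : vfield M := fun p =>
  A p (A p (bracket X Y p)) + bracket (ap A X) (ap A Y) p
  - A p (bracket (ap A X) Y p + bracket X (ap A Y) p).

(* Identities between tensor fields are imposed on all smooth vector fields
   defined on an open set, at all points of that set. *)
Definition fields2 M (P : vfield M -> vfield M -> M -> Prop) : Prop :=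
  forall (U : set M) (X Y : vfield M), open U ->
    smooth_vfield U X -> smooth_vfield U Y -> forall p, U p -> P X Y p.

Definition fields3 M (P : vfield M -> vfield M -> vfield M -> M -> Prop) : Prop :=
  forall (U : set M) (X Y Z : vfield M), open U ->
    smooth_vfield U X -> smooth_vfield U Y -> smooth_vfield U Z ->
    forall p, U p -> P X Y Z p.

Definition is_riemannian M (g : form2 M) : Prop :=
  [/\ is_tensor02 g, forall p v w, g p v w = g p w v
    & forall p v, v != 0 -> 0 < g p v v].

(* omega(X, Y) = g(X, J Y); also the fundamental form of an almost contact
   metric structure *)
Definition fundamental_form M (A : tensor11 M) (g : form2 M) : form2 M :=
  fun p v w => g p v (A p w).

(* J is an integrable almost complex structure (its Nijenhuis tensor vanishes),
   g is a Hermitian metric, and the Kaehler form is closed. *)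
Record is_kahler M (J : tensor11 M) (g : form2 M) : Prop := IsKahler {
  kahler_J : is_tensor11 J ;
  kahler_g : is_riemannian g ;
  kahler_JJ : forall p v, J p (J p v) = - v ;
  kahler_gJ : forall p v w, g p (J p v) (J p w) = g p v w ;
  kahler_integrable : fields2 (fun X Y p => nijenhuis J X Y p = 0) ;
  kahler_closed :
    fields3 (fun X Y Z p => ext_d2 (fundamental_form J g) X Y Z p = 0) }.

Record almost_contact_metric M (phi : tensor11 M) (xi : vfield M)
    (eta : form1 M) (g : form2 M) : Prop := AlmostContactMetric {
  acm_phi : is_tensor11 phi ;
  acm_xi : smooth_vfield setT xi ;
  acm_eta : is_form1 eta ;
  acm_g : is_riemannian g ;
  acm_phi2 : forall p v, phi p (phi p v) = - v + eta p v *: xi p ;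
  acm_eta_xi : forall p, eta p (xi p) = 1 ;
  acm_g_phi : forall p v w,
    g p (phi p v) (phi p w) = g p v w - eta p v * eta p w }.

Definition contact_metric M (phi : tensor11 M) (xi : vfield M)
    (eta : form1 M) (g : form2 M) : Prop :=
  almost_contact_metric phi xi eta g /\
  fields2 (fun X Y p =>
    ext_d1 eta X Y p = fundamental_form phi g p (X p) (Y p)).

Definition normal_structure M (phi : tensor11 M) (xi : vfield M)
    (eta : form1 M) : Prop :=
  fields2 (fun X Y p =>
    nijenhuis phi X Y p + (2 * ext_d1 eta X Y p) *: xi p = 0).

Definition sasakian M (phi : tensor11 M) (xi : vfield M)
    (eta : form1 M) (g : form2 M) : Prop :=
  contact_metric phi xi eta g /\ normal_structure phi xi eta.

End calculus.

Definition tmap (R : realType) (m1 m2 : nat)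
    (M1 : manifold R m1) (M2 : manifold R m2) (f : M1 -> M2) (p : M1)
    (v : 'rV[R]_m1) : 'rV[R]_m2 :=
  'd (chart (chart_at (f p)) \o f \o chart_inv (chart_at p))
     (chart (chart_at p) p) v.

Section lift.
Context {R : realType} {m : nat}.
Variable N : manifold R m.

Definition lift_space : manifold R (1 + m) := manifold_prod (real_line R) N.

Definition pi1 (z : lift_space) : real_line R := z.1.
Definition pi2 (z : lift_space) : N := z.2.

(* d/dt at (t, q): the image of the unit tangent vector of R at t under the
   tangent map of s |-> (s, q) *)
Definition lift_xi : vfield lift_space := fun z =>
  tmap (fun s : real_line R => (s, pi2 z) : lift_space) (pi1 z) (const_mx 1).

(* the vector at (t, q) tangent to N that corresponds to the vector v at q *)
Definition tangent_N (z : lift_space) (v : 'rV[R]_m) : 'rV[R]_(1 + m) :=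
  tmap (fun q : N => (pi1 z, q) : lift_space) (pi2 z) v.

Variables (tau : form1 N) (J : tensor11 N) (g : form2 N).

Definition lift_eta : form1 lift_space := fun z v =>
  dfun (M := lift_space) pi1 z v + tau (pi2 z) (tmap pi2 z v).

Definition lift_metric : form2 lift_space := fun z v w =>
  lift_eta z v * lift_eta z w + g (pi2 z) (tmap pi2 z v) (tmap pi2 z w).

(* The value at z of X^L, where v is the value of X at pi2 z *)
Definition hlift (z : lift_space) (v : 'rV[R]_m) : 'rV[R]_(1 + m) :=
  tangent_N z v - tau (pi2 z) v *: lift_xi z.

(* phi X^L = (J X)^L and phi xi = 0; these determine phi, as every tangent
   vector at z is the sum of some X^L and a multiple of xi. *)
Definition is_lift_tensor (phi : tensor11 lift_space) : Prop :=
  [/\ forall z, linear (phi z),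
      forall z v, phi z (hlift z v) = hlift z (J (pi2 z) v)
    & forall z, phi z (lift_xi z) = 0].

End lift.

(* Main.v *)
(* In a chart, with D_v the derivative of components along v, a 1-form T has
   2 dT(v, w) = D_v T(w) - D_w T(v), and a (1,1)-tensor A has the Nijenhuis
   tensor (D_{Av} A) w - (D_{Aw} A) v + A ((D_w A) v - (D_v A) w); both depend
   only on the values v, w of the fields at the point.  In the chart of R x N
   with coordinates (t, x), writing T, J for the components of tau, J and
   v = (v_0, v'), one has eta(v) = v_0 + T_x(v') and
   phi(v) = (- T_x(J_x v'), J_x v').  Hence d eta is the pullback of
   d tau = omega, the component along N of the Nijenhuis tensor of phi is that
   of J, which vanishes, and its component along xi is
   - 2 omega(J v', J w') = - 2 omega(v', w'), as required for normality. *)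
From HB Require Import structures.
Require Import Defs.
From mathcomp Require Import all_boot all_order all_algebra.
From mathcomp Require Import all_classical all_reals all_analysis.
From mathcomp Require Import ring.

Set Implicit Arguments.
Unset Strict Implicit.
Unset Printing Implicit Defensive.

Import Order.TTheory GRing.Theory Num.Theory.
Import numFieldNormedType.Exports.

Local Open Scope classical_set_scope.
Local Open Scope ring_scope.

(** * Differential calculus: product rules and maps that agree near a point *)

Section differentials.
Context {R : realType}.
Implicit Types V W : normedModType R.

(** Leibniz rule: scaling is a continuous bilinear map, packed as such in [sB] and composed with the
    pair of [k] and [f]. *)
Lemma is_diff_scale V W (k : V -> R) (f : V -> W) (dk : V -> R) (df : V -> W)
    (x : V) :
  is_diff x k dk -> is_diff x f df ->
  is_diff x (fun y => k y *: f y) (fun v => k x *: df v + dk v *: f x).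
Proof.
move=> hk hf.
pose s (a : R) (w : W) := a *: w.
have sb : bilinear_for *:%R *:%R s.
  split=> [w|a] b u v; rewrite /s /=; first by rewrite scalerDl -scalerA.
  by rewrite scalerDr !scalerA mulrC.
pose sM := bilinear_isBilinear.Build R R W W _ _ s sb.
pose sB : {bilinear R -> W -> W} := HB.pack s sM.
have sc : continuous (fun p : R * W => sB p.1 p.2).
  by move=> p; apply: (@scale_continuous _ W).
have hs : is_diff (k x, f x) (fun p : R * W => sB p.1 p.2)
    (fun p => k x *: p.2 + p.1 *: f x).
  by apply: DiffDef; [exact: differentiable_bilin | rewrite diff_bilin].
exact: (is_diff_comp (is_diff_pair hk hf) hs).
Qed.

Lemma near_eq_diff V W (f g : V -> W) (x v : V) :
  (\near x, f x = g x) -> differentiable f x -> 'd g x v = 'd f x v.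
Proof.
move=> fg df; have dg := near_eq_differentiable fg df.
by rewrite -!deriveE //; apply/esym; exact: near_eq_derive.
Qed.

(** The chain rule in the form that transition maps require: their composites are again transition
    maps only near the point, not as total functions. *)
Lemma diff_comp_near V V' W (f : V -> V') (g : V' -> W) (h : V -> W) x y v :
  f x = y -> differentiable f x -> differentiable g y ->
  (\near x, g (f x) = h x) -> 'd g y ('d f x v) = 'd h x v.
Proof.
move=> <- df dg fgh.
have dgf : differentiable (g \o f) x by exact: differentiable_comp.
rewrite (near_eq_diff v fgh dgf).
by have /funeqP/(_ v) -> := diff_comp df dg.
Qed.

Lemma diff_near_id V (f : V -> V) (x : V) :
  (\near x, f x = x) -> forall v, 'd f x v = v.
Proof.
move=> fE v; have eqf : \near x, id x = f x.
  by move: fE; apply: filterS => y ->.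
by rewrite (@near_eq_diff _ _ id f x v) // diff_val.
Qed.

Lemma is_diff_sum V W n (f df : 'I_n -> V -> W) (x : V) :
  (forall k, is_diff x (f k) (df k)) ->
  is_diff x (fun y => \sum_k f k y) (fun v => \sum_k df k v).
Proof.
move=> h.
have -> : (fun y => \sum_k f k y) = \sum_k f k.
  by apply/funext => y; rewrite fct_sumE.
have -> : (fun v => \sum_k df k v) = \sum_k df k.
  by apply/funext => y; rewrite fct_sumE.
apply: (big_ind2 (fun f df => is_diff x f df)) => //; first exact: is_diff_cst.
by move=> ? ? ? ?; exact: is_diffD.
Qed.

Fact coord_is_linear m (k : 'I_m) : linear (fun A : 'rV[R]_m => A 0 k).
Proof. by move=> a u v; rewrite !mxE. Qed.

Lemma is_diff_coord V m (f df : V -> 'rV[R]_m) (x : V) k :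
  is_diff x f df -> is_diff x (fun y => f y 0 k) (fun v => df v 0 k).
Proof.
move=> hf.
apply: (@is_diff_comp _ _ _ _ f df (fun A : 'rV[R]_m => A 0 k)
   (fun A : 'rV[R]_m => A 0 k)).
pose cM := GRing.isLinear.Build R 'rV[R]_m R _ _
  (coord_is_linear k).
pose cL : {linear 'rV[R]_m -> R} := HB.pack (fun A : 'rV[R]_m => A 0 k) cM.
have cc : continuous cL by move=> A; exact: coord_continuous.
apply: DiffDef; first exact: (linear_differentiable (f := cL)).
exact: (diff_lin (f := cL)).
Qed.

Lemma linear_row_sum W m (b : 'rV[R]_m -> W) : linear b ->
  forall v, b v = \sum_k v 0 k *: b (delta_mx 0 k).
Proof.
move=> bl v.
pose bM := GRing.isLinear.Build _ _ _ _ _ bl.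
pose bL : {linear _ -> _} := HB.pack b bM.
rewrite -[LHS]/(bL v) {1}(row_sum_delta v) linear_sum.
by apply: eq_bigr => k _; rewrite linearZ.
Qed.

(** Product rule for a family of linear maps applied to a moving vector. Expanding the vector in the
    standard basis turns the expression into a finite sum of scalings, so differentiability of [B]
    at each fixed vector suffices. *)
Lemma is_diff_apply V W m (B : V -> 'rV[R]_m -> W) (Y : V -> 'rV[R]_m)
    (dY : V -> 'rV[R]_m) (x : V) :
  (forall y, linear (B y)) -> (forall w, differentiable (B^~ w) x) ->
  is_diff x Y dY ->
  is_diff x (fun y => B y (Y y)) (fun v => 'd (B^~ (Y x)) x v + B x (dY v)).
Proof.
move=> Bl dB hY.
have BE (Z : V -> 'rV[R]_m) :
    (fun y => B y (Z y)) = (fun y => \sum_k Z y 0 k *: B y (delta_mx 0 k)).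
  by apply/funext => y; exact: linear_row_sum.
have h (Z dZ : V -> 'rV[R]_m) : is_diff x Z dZ ->
    is_diff x (fun y => B y (Z y)) (fun v => \sum_k
      (Z x 0 k *: 'd (B^~ (delta_mx 0 k)) x v
        + dZ v 0 k *: B x (delta_mx 0 k))).
  move=> hZ; rewrite BE; apply: is_diff_sum => k.
  by apply: is_diff_scale; [exact: is_diff_coord | exact: differentiableP].
apply: is_diff_eq (h _ _ hY) _.
apply/funext => v; rewrite big_split /= -linear_row_sum //; congr (_ + _).
(* The same expansion for the constant vector [Y x] identifies the first group of terms as the
   differential of [B^~ (Y x)]. *)
have := h (cst (Y x)) _ (is_diff_cst _ _) => h0.
rewrite (@diff_val _ _ _ _ _ _ _ h0); apply: eq_bigr => k _.
by rewrite mxE scale0r addr0.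
Qed.

Lemma is_diff_row_mx V m n (f df : V -> 'rV[R]_m) (g dg : V -> 'rV[R]_n) (x : V) :
  is_diff x f df -> is_diff x g dg ->
  is_diff x (fun y => row_mx (f y) (g y)) (fun v => row_mx (df v) (dg v)).
Proof.
move=> hf hg.
have hr : is_diff (f x, g x) (@row_pair R m n) (@row_pair R m n).
  apply: DiffDef; first exact/linear_differentiable/continuous_row_pair.
  by apply: diff_lin; exact: continuous_row_pair.
exact: (is_diff_comp (is_diff_pair hf hg) hr).
Qed.

Lemma is_diff_lsubmx m n (x : 'rV[R]_(m + n)) :
  is_diff x (lsubmx : 'rV[R]_(m + n) -> 'rV[R]_m) lsubmx.
Proof.
apply: DiffDef; first exact: differentiable_lsubmx.
by apply: diff_lin; exact: continuous_lsubmx.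
Qed.

Lemma is_diff_comp_rsubmx W m n (f : 'rV[R]_n -> W) (x : 'rV[R]_(m + n)) :
  differentiable f (rsubmx x) ->
  is_diff x (f \o rsubmx) (fun v => 'd f (rsubmx x) (rsubmx v)).
Proof.
move=> df.
have hr : is_diff x (rsubmx : 'rV[R]_(m + n) -> 'rV[R]_n) rsubmx.
  apply: DiffDef; first exact: differentiable_rsubmx.
  by apply: diff_lin; exact: continuous_rsubmx.
exact: (is_diff_comp hr (differentiableP df)).
Qed.

Lemma is_diffE V W (f df : V -> W) (x v : V) :
  is_diff x f df -> 'd f x v = df v.
Proof. by case=> _ ->. Qed.

End differentials.

(** * Closure properties of smooth maps *)

Section smooth.
Context {R : realType}.
Implicit Types V W : normedModType R.

Fact row_mx_left_is_linear m n : linear (fun u : 'rV[R]_m => row_mx u (0 : 'rV[R]_n)).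
Proof. by move=> a u v; rewrite scale_row_mx add_row_mx scaler0 addr0. Qed.

Fact row_mx_right_is_linear m n : linear (fun u : 'rV[R]_n => row_mx (0 : 'rV[R]_m) u).
Proof. by move=> a u v; rewrite scale_row_mx add_row_mx scaler0 addr0. Qed.

(** Truncating at order [n] allows induction on the order: the derivative of a product is a sum of
    products of lower order, and the induction hypothesis applies to each summand. *)
Definition smooth_upto n V W (U : set V) (f : V -> W) :=
  forall (vs : seq V) (x : V), (size vs <= n)%N -> U x ->
    differentiable (iter_derive vs f) x.

Lemma smooth_onP V W (U : set V) (f : V -> W) :
  smooth_on U f <-> forall n, smooth_upto n U f.
Proof.
split=> [h n vs x _|h vs x]; first exact: h.
exact: (h (size vs)).
Qed.

Lemma smooth_on_differentiable V W (U : set V) (f : V -> W) x :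
  smooth_on U f -> U x -> differentiable f x.
Proof. by move=> h; exact: (h [::]). Qed.

Lemma smooth_upto_differentiable n V W (U : set V) (f : V -> W) x :
  smooth_upto n U f -> U x -> differentiable f x.
Proof. by move=> h; exact: (h [::]). Qed.

Lemma smooth_upto_derive n V W (U : set V) (f : V -> W) v :
  smooth_upto n.+1 U f -> smooth_upto n U ('D_v f).
Proof. by move=> h vs x vsn; exact: (h (v :: vs)). Qed.

Lemma smooth_uptoS n V W (U : set V) (f : V -> W) :
  (forall x, U x -> differentiable f x) ->
  (forall v, smooth_upto n U ('D_v f)) -> smooth_upto n.+1 U f.
Proof. by move=> h0 h [|v vs] x /= ?; [exact: h0 | exact: h]. Qed.

Lemma smooth_uptoW n V W (U : set V) (f : V -> W) :
  smooth_upto n.+1 U f -> smooth_upto n U f.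
Proof. by move=> h vs x vsn; apply: h; rewrite (leq_trans vsn). Qed.

Lemma eq_on_smooth_upto n V W (U : set V) (f g : V -> W) :
  open U -> (forall x, U x -> f x = g x) ->
  smooth_upto n U f -> smooth_upto n U g.
Proof.
move=> oU fg sf vs x vsn Ux; apply: near_eq_differentiable (sf vs x vsn Ux).
move: (open_nbhs_nbhs (conj oU Ux)); apply: filterS => z Uz.
exact: eq_on_iter_derive Uz.
Qed.

Lemma sub_smooth_on V W (U U' : set V) (f : V -> W) :
  U' `<=` U -> smooth_on U f -> smooth_on U' f.
Proof. by move=> UU' h vs x /UU'; exact: h. Qed.

Lemma smooth_on_cst V W (U : set V) (w : W) : smooth_on U (cst w : V -> W).
Proof.
move=> vs x _; elim: vs w => [|v vs ih] w /=; first exact: differentiable_cst.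
have -> : 'D_v (cst w : V -> W) = cst 0 by apply/funext => y; exact: derive_cst.
exact: ih.
Qed.

Lemma smooth_upto_add n V W (U : set V) (f g : V -> W) : open U ->
  smooth_upto n U f -> smooth_upto n U g -> smooth_upto n U (fun x => f x + g x).
Proof.
move=> oU; elim: n f g => [|n ih] f g sf sg.
  case=> [|? ?] x; rewrite /= ?ltn0 // => _ Ux; apply: differentiableD;
    [exact: (smooth_upto_differentiable sf) | exact: (smooth_upto_differentiable sg)].
apply: smooth_uptoS => [x Ux|v].
  by apply: differentiableD;
    [exact: (smooth_upto_differentiable sf) | exact: (smooth_upto_differentiable sg)].
apply: (eq_on_smooth_upto (f := fun x => 'D_v f x + 'D_v g x)) => //.
  move=> x Ux; rewrite -[RHS]/('D_v (f + g) x) deriveD //; apply: diff_derivable;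
    [exact: (smooth_upto_differentiable sf) | exact: (smooth_upto_differentiable sg)].
by apply: ih; exact: smooth_upto_derive.
Qed.

Lemma smooth_upto_scale n V W (U : set V) (k : V -> R) (f : V -> W) : open U ->
  smooth_upto n U k -> smooth_upto n U f ->
  smooth_upto n U (fun x => k x *: f x).
Proof.
move=> oU; elim: n k f => [|n ih] k f sk sf.
  case=> [|? ?] x; rewrite /= ?ltn0 // => _ Ux; have [] // := is_diff_scale
    (differentiableP (smooth_upto_differentiable sk Ux))
    (differentiableP (smooth_upto_differentiable sf Ux)).
have hd x (Ux : U x) := is_diff_scale
    (differentiableP (smooth_upto_differentiable sk Ux))
    (differentiableP (smooth_upto_differentiable sf Ux)).
apply: smooth_uptoS => [x Ux|v]; first by have [] := hd x Ux.
apply: (eq_on_smooth_upto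
  (f := fun x => k x *: 'D_v f x + 'D_v k x *: f x)) => //.
  move=> x Ux; have [dx dE] := hd x Ux; rewrite [RHS]deriveE // dE !deriveE //.
    exact: (smooth_upto_differentiable sk).
  exact: (smooth_upto_differentiable sf).
(* In each summand of the Leibniz rule one factor has been differentiated; the other one is weakened
   from order [n.+1] to order [n]. *)
by apply: smooth_upto_add => //; apply: ih;
  (exact: smooth_upto_derive || exact: smooth_uptoW).
Qed.

Lemma smooth_on_add V W (U : set V) (f g : V -> W) : open U ->
  smooth_on U f -> smooth_on U g -> smooth_on U (fun x => f x + g x).
Proof.
by move=> oU /smooth_onP sf /smooth_onP sg; apply/smooth_onP => n;
  exact: smooth_upto_add.
Qed.

Lemma smooth_on_scale V W (U : set V) (k : V -> R) (f : V -> W) : open U ->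
  smooth_on U k -> smooth_on U f -> smooth_on U (fun x => k x *: f x).
Proof.
by move=> oU /smooth_onP sk /smooth_onP sf; apply/smooth_onP => n;
  exact: smooth_upto_scale.
Qed.

Lemma smooth_upto_sum n V W (U : set V) k (f : 'I_k -> V -> W) : open U ->
  (forall i, smooth_upto n U (f i)) -> smooth_upto n U (fun x => \sum_i f i x).
Proof.
move=> oU sf.
have -> : (fun y => \sum_i f i y) = \sum_i f i.
  by apply/funext => y; rewrite fct_sumE.
elim/big_ind : _ => //; last by move=> ? ? ? ?; exact: smooth_upto_add.
by have /smooth_onP := @smooth_on_cst V W U 0; apply.
Qed.

Lemma smooth_on_sum V W (U : set V) k (f : 'I_k -> V -> W) : open U ->
  (forall i, smooth_on U (f i)) -> smooth_on U (fun x => \sum_i f i x).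
Proof.
move=> oU sf; apply/smooth_onP => n; apply: smooth_upto_sum => // i.
by have /smooth_onP := sf i; apply.
Qed.

(** A continuous linear map commutes with directional derivatives, so the iterated derivatives of
    [l \o f] are the images under [l] of those of [f]. *)
Lemma smooth_on_lin V W W' (U : set V) (f : V -> W) (l : {linear W -> W'}) :
  open U -> continuous l -> smooth_on U f -> smooth_on U (l \o f).
Proof.
move=> oU lc sf vs; elim: vs f sf => [|v vs ih] f sf x Ux /=.
  apply: differentiable_comp; first exact: smooth_on_differentiable Ux.
  exact: linear_differentiable.
apply: near_eq_differentiable (ih _ (smooth_on_derive v sf) x Ux).
move: (open_nbhs_nbhs (conj oU Ux)); apply: filterS => z Uz.
apply: (eq_on_iter_derive (U := U)) => //= y Uy.
have dy := smooth_on_differentiable sf Uy.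
have dl : differentiable l (f y) by exact: linear_differentiable.
rewrite [RHS]deriveE; last exact: differentiable_comp.
by rewrite diff_comp //= diff_lin // deriveE.
Qed.

Lemma smooth_on_row_pair V m n (U : set V) (f : V -> 'rV[R]_m)
    (g : V -> 'rV[R]_n) : open U -> smooth_on U f -> smooth_on U g ->
  smooth_on U (fun x => row_mx (f x) (g x)).
Proof.
move=> oU sf sg.
pose l1M := GRing.isLinear.Build R 'rV[R]_m 'rV[R]_(m + n) _ _
  (@row_mx_left_is_linear m n).
pose l1 : {linear 'rV[R]_m -> 'rV[R]_(m + n)} := HB.pack
  (fun u : 'rV[R]_m => row_mx u (0 : 'rV[R]_n)) l1M.
pose l2M := GRing.isLinear.Build R 'rV[R]_n 'rV[R]_(m + n) _ _
  (@row_mx_right_is_linear m n).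
pose l2 : {linear 'rV[R]_n -> 'rV[R]_(m + n)} := HB.pack
  (fun u : 'rV[R]_n => row_mx (0 : 'rV[R]_m) u) l2M.
have c1 : continuous l1.
  move=> x; apply: (differentiable_continuous (f := l1)).
  by have [] := is_diff_row_mx (is_diff_id x) (is_diff_cst (0 : 'rV[R]_n) x).
have c2 : continuous l2.
  move=> x; apply: (differentiable_continuous (f := l2)).
  by have [] := is_diff_row_mx (is_diff_cst (0 : 'rV[R]_m) x) (is_diff_id x).
(* The row is the sum of its two blocks, each embedded by a continuous linear map. *)
apply: (eq_on_smooth_on (f := fun x => (l1 \o f) x + (l2 \o g) x)) => //.
  by move=> x _ /=; rewrite add_row_mx addr0 add0r.
by apply: smooth_on_add => //; exact: smooth_on_lin.
Qed.

Lemma smooth_on_coord V m (U : set V) (f : V -> 'rV[R]_m) k :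
  open U -> smooth_on U f -> smooth_on U (fun x => f x 0 k).
Proof.
move=> oU sf.
pose cM := GRing.isLinear.Build R 'rV[R]_m R _ _
  (coord_is_linear k).
pose cL : {linear 'rV[R]_m -> R} := HB.pack (fun A : 'rV[R]_m => A 0 k) cM.
by apply: (smooth_on_lin (l := cL)) => // A; exact: coord_continuous.
Qed.

Lemma smooth_on_apply V W m (U : set V) (B : V -> 'rV[R]_m -> W)
    (Y : V -> 'rV[R]_m) : open U ->
  (forall y, linear (B y)) -> (forall w, smooth_on U (B^~ w)) ->
  smooth_on U Y -> smooth_on U (fun x => B x (Y x)).
Proof.
move=> oU Bl sB sY.
have -> : (fun y => B y (Y y)) = (fun y => \sum_k Y y 0 k *: B y (delta_mx 0 k)).
  by apply/funext => y; exact: linear_row_sum.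
by apply: smooth_on_sum => // k; apply: smooth_on_scale => //; exact: smooth_on_coord.
Qed.

(** By the chain rule, ['D_v (f \o g)] is the sum over [k] of the [k]-th component of ['D_v g] times
    the [k]-th partial derivative of [f] composed with [g]. The induction on the order therefore
    ranges over all smooth [f], with [g] fixed. *)
Lemma smooth_on_comp V W m (U : set V) (U' : set 'rV[R]_m) (f : 'rV[R]_m -> W)
    (g : V -> 'rV[R]_m) : open U -> U `<=` g @^-1` U' ->
  smooth_on U' f -> smooth_on U g -> smooth_on U (f \o g).
Proof.
move=> oU UU' sf sg; apply/smooth_onP => n.
have hd h : smooth_on U' h -> forall x, U x -> is_diff x (h \o g)
    ('d h (g x) \o 'd g x).
  move=> sh x Ux; apply: is_diff_comp; apply: differentiableP.
    exact: smooth_on_differentiable Ux.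
  exact/(smooth_on_differentiable sh)/UU'.
elim: n f sf => [|n ih] f sf.
  by case=> [|? ?] x; rewrite /= ?ltn0 // => _ Ux /=; have [] := hd _ _ sf _ Ux.
apply: smooth_uptoS => [x Ux|v]; first by have [] := hd _ _ sf _ Ux.
apply: (eq_on_smooth_upto
  (f := fun x => \sum_k ('D_v g x) 0 k *: ('D_(delta_mx 0 k) f \o g) x)) => //.
  move=> x Ux; have [dx dE] := hd _ _ sf x Ux; rewrite [RHS]deriveE // dE /=.
  have df := smooth_on_differentiable sf (UU' _ Ux).
  rewrite (linear_row_sum (b := 'd f (g x))); last exact: linearP.
  apply: eq_bigr => k _; rewrite !deriveE //.
  exact: smooth_on_differentiable Ux.
apply: smooth_upto_sum => // k; apply: smooth_upto_scale => //; last first.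
  by apply: ih; exact: smooth_on_derive.
by have /smooth_onP := smooth_on_coord k oU (smooth_on_derive v sg); apply.
Qed.

Lemma smooth_on_comp_rsubmx W m n (U : set 'rV[R]_n) (f : 'rV[R]_n -> W) :
  open U -> smooth_on U f ->
  smooth_on [set y : 'rV[R]_(m + n) | U (rsubmx y)] (f \o rsubmx).
Proof.
move=> oU sf.
have oD : open [set y : 'rV[R]_(m + n) | U (rsubmx y)].
  by apply: (open_comp _ oU) => x _; exact: continuous_rsubmx.
apply: (smooth_on_comp oD _ sf) => //.
apply: linear_continuous_smooth_on; exact: continuous_rsubmx.
Qed.

End smooth.

(** * Vector fields and tensors in the coordinates of a chart *)

Section charts.
Context {R : realType} {m : nat} {M : manifold R m}.
Implicit Types (i j k : mindex M) (p : M) (U : set M) (X Y : vfield M).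

(** The map [chart_inv i] is continuous only at points of [mcod i], so openness is checked point by
    point. *)
Lemma open_chart_preimage i U : open U ->
  open [set x | mcod i x /\ U (chart_inv i x)].
Proof.
move=> oU; rewrite openE => x [ix jx]; rewrite /interior.
apply: (@filterI _ (nbhs x)).
  by apply: open_nbhs_nbhs; split => //; exact: mcod_open.
by apply: (chart_inv_continuous ix); exact: open_nbhs_nbhs.
Qed.

Lemma near_chart i U p : open U -> U p -> mdom i p ->
  \forall x \near chart i p, mcod i x /\ U (chart_inv i x).
Proof.
move=> oU Up ip; apply: open_nbhs_nbhs; split; first exact: open_chart_preimage.
by rewrite /= chartK //; split => //; exact: chart_cod.
Qed.

Lemma differentiable_transition i j p : mdom i p -> mdom j p ->
  differentiable (chart j \o chart_inv i) (chart i p).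
Proof.
move=> ip jp;
  apply: (smooth_on_differentiable (x := chart i p) (@chart_transition _ _ M i j)).
by rewrite /= chartK //; split => //; exact: chart_cod.
Qed.

(** Cocycle rule for coordinate changes of tangent vectors; the middle chart cancels only where it
    is defined, which is a neighbourhood of [chart i p]. *)
Lemma diff_transition_comp i j k p v : mdom i p -> mdom j p -> mdom k p ->
  'd (chart k \o chart_inv j) (chart j p)
    ('d (chart j \o chart_inv i) (chart i p) v) =
  'd (chart k \o chart_inv i) (chart i p) v.
Proof.
move=> ip jp kp.
apply: (diff_comp_near (x := chart i p) (y := chart j p)).
- by rewrite /= chartK.
- exact: differentiable_transition.
- exact: differentiable_transition.
move: (near_chart (@mdom_open _ _ M j) jp ip); apply: filterS => x [ix jx].
by rewrite /= chartK.
Qed.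

Lemma diff_transition_id i p v : mdom i p ->
  'd (chart i \o chart_inv i) (chart i p) v = v.
Proof.
move=> ip; apply: diff_near_id.
move: (near_chart openT I ip); apply: filterS => x [ix _] /=.
by rewrite chart_invK.
Qed.

Lemma form1D (theta : form1 M) p u v :
  is_form1 theta -> theta p (u + v) = theta p u + theta p v.
Proof. by move=> [tl _]; have := tl p 1 u v; rewrite scale1r mul1r. Qed.

Lemma form1_0 (theta : form1 M) p : is_form1 theta -> theta p 0 = 0.
Proof.
by move=> [tl _]; have := tl p (-1) 0 0; rewrite scaler0 addr0 mulN1r addNr.
Qed.

Lemma form1N (theta : form1 M) p v : is_form1 theta -> theta p (- v) = - theta p v.
Proof.
by move=> th; apply/eqP; rewrite -addr_eq0 -form1D // addNr form1_0.
Qed.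

(* The field with constant components w in the chart i. *)
Definition coord_field i (w : 'rV[R]_m) : vfield M := fun p =>
  'd (chart (chart_at p) \o chart_inv i) (chart i p) w.

Lemma coord_field_is_linear i p : linear (coord_field i ^~ p).
Proof. by move=> a u v; rewrite /coord_field linearP. Qed.

Lemma chart_vec_is_linear i p : linear (chart_vec i p).
Proof. by move=> a u v; rewrite /chart_vec linearP. Qed.

Lemma chart_vecK i p v : mdom i p -> coord_field i (chart_vec i p v) p = v.
Proof.
move=> ip; have dp := chart_at_dom p.
by rewrite [LHS](diff_transition_comp v dp ip dp) diff_transition_id.
Qed.

Lemma chart_vec_at p v : chart_vec (chart_at p) p v = v.
Proof. exact/diff_transition_id/chart_at_dom. Qed.

Lemma coord_field_at p v : coord_field (chart_at p) v p = v.
Proof. exact/diff_transition_id/chart_at_dom. Qed.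

(** In a chart [j], the components are the derivative along [w] of the transition from [i] to [j],
    evaluated at the transition from [j] to [i]. Both maps are smooth. *)
Lemma smooth_coord_field i w : smooth_vfield (mdom i) (coord_field i w).
Proof.
move=> j; have oD := @open_chart_preimage j _ (@mdom_open _ _ M i).
apply: (eq_on_smooth_on
    (f := 'D_w (chart j \o chart_inv i) \o (chart i \o chart_inv j))) => //.
  move=> x [jx ix] /=; set p := chart_inv j x.
  have jp : mdom j p by exact: chart_inv_dom.
  rewrite deriveE; last exact: differentiable_transition.
  exact: (esym (diff_transition_comp w ix (chart_at_dom p) jp)).
have sT := smooth_on_derive w (@chart_transition _ _ M i j).
apply: (smooth_on_comp oD _ sT (@chart_transition _ _ M j i)).
move=> x [jx ix] /=; split; first exact: chart_cod.
by rewrite chartK //; exact: chart_inv_dom.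
Qed.

(** The coefficients in the fixed chart [i]. For fixed [w] they are functions on an open set of R^m,
    free of the discontinuous choice [chart_at], and can be differentiated in [x]. *)
Definition local_form1 (theta : form1 M) i (x w : 'rV[R]_m) : R :=
  theta (chart_inv i x) (coord_field i w (chart_inv i x)).

Definition local_form2 (b : form2 M) i (x v w : 'rV[R]_m) : R :=
  b (chart_inv i x) (coord_field i v (chart_inv i x))
    (coord_field i w (chart_inv i x)).

Definition local_tensor11 (A : tensor11 M) i (x w : 'rV[R]_m) : 'rV[R]_m :=
  chart_vec i (chart_inv i x)
    (A (chart_inv i x) (coord_field i w (chart_inv i x))).

Lemma chart_fieldK i X x : mcod i x ->
  coord_field i (chart_field i X x) (chart_inv i x) = X (chart_inv i x).
Proof. by move=> ix; rewrite chart_vecK //; exact: chart_inv_dom. Qed.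

(** Differentials are linear as total maps, so linearity in the vector holds at every [x], even
    outside [mcod i], as [is_diff_apply] and [smooth_on_apply] require. *)
Lemma local_form1_is_linear theta i x :
  (forall p, scalar (theta p)) -> linear (local_form1 theta i x).
Proof.
by move=> tl a u v; rewrite /local_form1 coord_field_is_linear tl.
Qed.

Lemma local_tensor11_is_linear A i x :
  (forall p, linear (A p)) -> linear (local_tensor11 A i x).
Proof.
move=> Al a u v.
by rewrite /local_tensor11 coord_field_is_linear Al chart_vec_is_linear.
Qed.

Lemma chart_preimage_mdom i :
  mcod i `<=` [set x | mcod i x /\ mdom i (chart_inv i x)].
Proof. by move=> x ix; split => //; exact: chart_inv_dom. Qed.

(** Smoothness tested on the coordinate field of [w], which is smooth on the whole domain of the
    chart. *)
Lemma is_form1_local theta i w :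
  is_form1 theta -> smooth_on (mcod i) (local_form1 theta i ^~ w).
Proof.
move=> [_ st]; apply: sub_smooth_on (@chart_preimage_mdom i) _.
exact: (st _ _ (@mdom_open _ _ M i) (@smooth_coord_field i w) i).
Qed.

Lemma is_tensor11_local A i w :
  is_tensor11 A -> smooth_on (mcod i) (local_tensor11 A i ^~ w).
Proof.
move=> [_ st]; apply: sub_smooth_on (@chart_preimage_mdom i) _.
exact: (st _ _ (@mdom_open _ _ M i) (@smooth_coord_field i w) i).
Qed.

Lemma is_tensor02_local b i v w :
  is_tensor02 b -> smooth_on (mcod i) (fun x => local_form2 b i x v w).
Proof.
move=> [_ _ st]; apply: sub_smooth_on (@chart_preimage_mdom i) _.
exact: (st _ _ _ (@mdom_open _ _ M i) (@smooth_coord_field i v)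
  (@smooth_coord_field i w) i).
Qed.

(** Converse of [is_form1_local]: in a chart, the form on a field is its coefficients applied to the
    components of the field, which is smooth by [smooth_on_apply]. *)
Lemma local_is_form1 theta : (forall p, scalar (theta p)) ->
  (forall i w, smooth_on (mcod i) (local_form1 theta i ^~ w)) -> is_form1 theta.
Proof.
move=> tl ts; split=> // U X oU sX i.
have oD := @open_chart_preimage i _ oU.
apply: (eq_on_smooth_on
    (f := fun x => local_form1 theta i x (chart_field i X x))) => //.
  by move=> x [ix _]; rewrite /local_form1 chart_fieldK.
apply: smooth_on_apply => //; first by move=> y; exact: local_form1_is_linear.
by move=> w; apply: sub_smooth_on (ts i w) => x [].
Qed.

Lemma local_is_tensor11 A : (forall p, linear (A p)) ->
  (forall i w, smooth_on (mcod i) (local_tensor11 A i ^~ w)) -> is_tensor11 A.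
Proof.
move=> tl ts; split=> // U X oU sX i.
have oD := @open_chart_preimage i _ oU.
apply: (eq_on_smooth_on
    (f := fun x => local_tensor11 A i x (chart_field i X x))) => //.
  by move=> x [ix _]; rewrite /local_tensor11 chart_fieldK.
apply: smooth_on_apply => //; first by move=> y; exact: local_tensor11_is_linear.
by move=> w; apply: sub_smooth_on (ts i w) => x [].
Qed.

Lemma local_is_tensor02 b : (forall p v, scalar (b p v)) ->
  (forall p w, scalar (b p ^~ w)) ->
  (forall i v w, smooth_on (mcod i) (fun x => local_form2 b i x v w)) ->
  is_tensor02 b.
Proof.
move=> bl1 bl2 bs; split=> // U X Y oU sX sY i.
have oD := @open_chart_preimage i _ oU.
apply: (eq_on_smooth_on
    (f := fun x => local_form2 b i x (chart_field i X x) (chart_field i Y x))) => //.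
  by move=> x [ix _]; rewrite /local_form2 !chart_fieldK.
(* The two arguments are treated in turn: first [Y] is replaced by a constant vector, then [X]. *)
apply: (smooth_on_apply (B := fun x => local_form2 b i x (chart_field i X x))) => //.
  by move=> x a u v; rewrite /local_form2 coord_field_is_linear bl1.
move=> w; apply: (smooth_on_apply (B := fun x v => local_form2 b i x v w)) => //.
  by move=> x a u v; rewrite /local_form2 coord_field_is_linear bl2.
by move=> v; apply: sub_smooth_on (bs i v w) => x [].
Qed.

(** * Derivative formulas at a point, in the chart chosen there *)

Section at_point.
Variables (U : set M) (p : M).
Hypotheses (oU : open U) (Up : U p).
Local Notation i := (chart_at p).
Local Notation x0 := (chart (chart_at p) p).

Lemma differentiable_chart_field X : smooth_vfield U X ->
  differentiable (chart_field i X) x0.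
Proof.
move=> sX; apply: (smooth_on_differentiable (x := x0) (sX i)).
rewrite /= chartK; last exact: chart_at_dom.
by split => //; exact/chart_cod/chart_at_dom.
Qed.

Lemma chart_field_at X : chart_field i X x0 = X p.
Proof. by rewrite /chart_field chartK ?chart_vec_at //; exact: chart_at_dom. Qed.

Lemma local_form1_at theta w : local_form1 theta i x0 w = theta p w.
Proof. by rewrite /local_form1 chartK ?coord_field_at //; exact: chart_at_dom. Qed.

Lemma local_tensor11_at A w : local_tensor11 A i x0 w = A p w.
Proof.
rewrite /local_tensor11 chartK ?coord_field_at ?chart_vec_at //.
exact: chart_at_dom.
Qed.

(** The product rule in the chart: one term differentiates the coefficients of the form, the other
    the components of the field. *)
Lemma dfun_form1 theta Y v : is_form1 theta -> smooth_vfield U Y ->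
  dfun (fun q => theta q (Y q)) p v =
  'd (local_form1 theta i ^~ (Y p)) x0 v
    + theta p ('d (chart_field i Y) x0 v).
Proof.
move=> ht sY; have [tl _] := ht.
have c0 : mcod i x0 by exact/chart_cod/chart_at_dom.
have hd := is_diff_apply (B := local_form1 theta i)
  (fun y => @local_form1_is_linear theta i y tl)
  (fun w => smooth_on_differentiable (x := x0) (@is_form1_local _ i w ht) c0)
  (differentiableP (differentiable_chart_field sY)).
have [dY dE] := hd.
move: dE => /funeqP/(_ v); rewrite local_form1_at chart_field_at => <-.
apply: (near_eq_diff (x := x0)) dY.
move: (near_chart oU Up (chart_at_dom p)); apply: filterS => x [ix _] /=.
by rewrite /local_form1 chart_fieldK.
Qed.

(** The derivatives of the components of [X] and [Y] cancel against [theta] of the bracket. *)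
Lemma ext_d1_local theta X Y : is_form1 theta ->
  smooth_vfield U X -> smooth_vfield U Y ->
  ext_d1 theta X Y p =
  2^-1 * ('d (local_form1 theta i ^~ (Y p)) x0 (X p)
          - 'd (local_form1 theta i ^~ (X p)) x0 (Y p)).
Proof.
move=> ht sX sY.
rewrite /ext_d1 !dfun_form1 // /bracket form1D // form1N //.
by congr (_ * _); ring.
Qed.

Lemma diff_chart_field_ap A Y v : is_tensor11 A -> smooth_vfield U Y ->
  'd (chart_field i (ap A Y)) x0 v =
  'd (local_tensor11 A i ^~ (Y p)) x0 v + A p ('d (chart_field i Y) x0 v).
Proof.
move=> ht sY; have [tl _] := ht.
have c0 : mcod i x0 by exact/chart_cod/chart_at_dom.
have hd := is_diff_apply (B := local_tensor11 A i)
  (fun y => @local_tensor11_is_linear A i y tl)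
  (fun w => smooth_on_differentiable (x := x0) (@is_tensor11_local _ i w ht) c0)
  (differentiableP (differentiable_chart_field sY)).
have [dY dE] := hd.
move: dE => /funeqP/(_ v); rewrite local_tensor11_at chart_field_at => <-.
apply: (near_eq_diff (x := x0)) dY.
move: (near_chart oU Up (chart_at_dom p)); apply: filterS => x [ix _] /=.
by rewrite /local_tensor11 chart_fieldK.
Qed.

(** The derivatives of the components of [X] and [Y] cancel by linearity of [A p] alone, so the
    formula serves both [J] and [phi]. *)
Lemma nijenhuis_local A X Y : is_tensor11 A ->
  smooth_vfield U X -> smooth_vfield U Y ->
  nijenhuis A X Y p =
  'd (local_tensor11 A i ^~ (Y p)) x0 (A p (X p))
    - 'd (local_tensor11 A i ^~ (X p)) x0 (A p (Y p))
    + A p ('d (local_tensor11 A i ^~ (X p)) x0 (Y p)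
           - 'd (local_tensor11 A i ^~ (Y p)) x0 (X p)).
Proof.
move=> hA sX sY; have [Al _] := hA.
pose AM := GRing.isLinear.Build _ _ _ _ _ (Al p).
pose AL : {linear 'rV[R]_m -> 'rV[R]_m} := HB.pack (A p) AM.
have AN v : A p (- v) = - A p v by exact: (linearN AL).
have AD u v : A p (u + v) = A p u + A p v by exact: (linearD AL).
have bAA : bracket (ap A X) (ap A Y) p =
    ('d (local_tensor11 A i ^~ (Y p)) x0 (A p (X p))
      + A p ('d (chart_field i Y) x0 (A p (X p))))
    - ('d (local_tensor11 A i ^~ (X p)) x0 (A p (Y p))
      + A p ('d (chart_field i X) x0 (A p (Y p)))).
  by congr (_ - _); exact: diff_chart_field_ap.
have bAI : bracket (ap A X) Y p = 'd (chart_field i Y) x0 (A p (X p))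
    - ('d (local_tensor11 A i ^~ (X p)) x0 (Y p)
      + A p ('d (chart_field i X) x0 (Y p))).
  by congr (_ - _); exact: diff_chart_field_ap.
have bIA : bracket X (ap A Y) p =
    ('d (local_tensor11 A i ^~ (Y p)) x0 (X p)
      + A p ('d (chart_field i Y) x0 (X p)))
    - 'd (chart_field i X) x0 (A p (Y p)).
  by congr (_ - _); exact: diff_chart_field_ap.
have nE b0 b1 b2 b3 : bracket X Y p = b0 ->
    bracket (ap A X) (ap A Y) p = b1 -> bracket (ap A X) Y p = b2 ->
    bracket X (ap A Y) p = b3 ->
    nijenhuis A X Y p = A p (A p b0) + b1 - A p (b2 + b3).
  by move=> <- <- <- <-.
have b0E : bracket X Y p =
  'd (chart_field i Y) x0 (X p) - 'd (chart_field i X) x0 (Y p) by [].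
rewrite (nE _ _ _ _ b0E bAA bAI bIA) {nE b0E bAA bAI bIA}.
(* The [a]'s stand for derivatives of the coefficients of [A], the [b]'s for derivatives of the
   components of the fields. *)
have alg a1 a2 a3 a4 b1 b2 b3 b4 :
    A p (A p (b1 - b2)) + ((a1 + A p b3) - (a2 + A p b4))
      - A p ((b3 - (a4 + A p b2)) + ((a3 + A p b1) - b4))
    = a1 - a2 + A p (a4 - a3).
  by rewrite !(AN, AD); apply/rowP => k; rewrite !mxE; ring.
exact: alg.
Qed.

End at_point.

End charts.

(** * Coordinates on the product of the real line with N *)

Section lift_space.
Context {R : realType} {m : nat} {N : manifold R m}.
Local Notation L := (lift_space N).
Implicit Types (i j : mindex N) (z : L).

Lemma lift_transitionE i j y :
  (chart ((tt, j) : mindex L) \o chart_inv ((tt, i) : mindex L)) y =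
  row_mx (lsubmx y) ((chart j \o chart_inv i) (rsubmx y)).
Proof.
congr row_mx; apply/rowP => k; rewrite mxE ord1 /=.
by [].
Qed.

Lemma rsubmx_chart i z : rsubmx (chart ((tt, i) : mindex L) z) = chart i z.2.
Proof. exact: row_mxKr. Qed.

Lemma diff_row_lsubmx n (f : 'rV[R]_m -> 'rV[R]_n) (y : 'rV[R]_(1 + m)) x v :
  rsubmx y = x -> differentiable f x ->
  'd (fun y : 'rV[R]_(1 + m) => row_mx (lsubmx y) (f (rsubmx y))) y v
  = row_mx (lsubmx v) ('d f x (rsubmx v)).
Proof.
move=> <- df.
exact: (is_diffE _ (is_diff_row_mx (is_diff_lsubmx y) (is_diff_comp_rsubmx df))).
Qed.

(** The real line has a single chart, so a coordinate change of the product is the identity in t and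
    a coordinate change of N in the other coordinates. *)
Lemma diff_lift_transition i j z v : mdom i z.2 -> mdom j z.2 ->
  'd (chart ((tt, j) : mindex L) \o chart_inv ((tt, i) : mindex L))
     (chart ((tt, i) : mindex L) z) v =
  row_mx (lsubmx v) ('d (chart j \o chart_inv i) (chart i z.2) (rsubmx v)).
Proof.
move=> iz jz; rewrite -(diff_row_lsubmx v (rsubmx_chart i z)
  (differentiable_transition iz jz)).
have -> : chart ((tt, j) : mindex L) \o chart_inv ((tt, i) : mindex L) =
  fun y : 'rV[R]_(1 + m) => row_mx (lsubmx y) ((chart j \o chart_inv i) (rsubmx y)).
  by apply/funext => y; exact: lift_transitionE.
by [].
Qed.

Lemma lift_coord_field i w z : mdom i z.2 ->
  coord_field ((tt, i) : mindex L) w z =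
  row_mx (lsubmx w) (coord_field i (rsubmx w) z.2).
Proof. by move=> iz; exact: diff_lift_transition iz (chart_at_dom z.2). Qed.

Lemma lift_chart_vec i v z : mdom i z.2 ->
  chart_vec ((tt, i) : mindex L) z v =
  row_mx (lsubmx v) (chart_vec i z.2 (rsubmx v)).
Proof. by move=> iz; exact: diff_lift_transition (chart_at_dom z.2) iz. Qed.

(** The chart chosen at [z] is built from the one chosen at [z.2]. Read in these charts, the
    projection is [rsubmx] followed by the transition of a chart to itself, whose differential is
    the identity. *)
Lemma tmap_pi2 z v : tmap (@pi2 R m N) z v = rsubmx v.
Proof.
have dt := differentiable_transition (chart_at_dom z.2) (chart_at_dom z.2).
move: (dt); rewrite -(rsubmx_chart _ z) => dt'.
apply: (etrans (is_diffE v (is_diff_comp_rsubmx dt'))).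
by rewrite rsubmx_chart; exact/diff_transition_id/chart_at_dom.
Qed.

Lemma dfun_pi1 z v : dfun (M := L) (@pi1 R m N) z v = lsubmx v 0 0.
Proof. exact: (is_diffE v (is_diff_coord 0 (is_diff_lsubmx _))). Qed.

Lemma diff_row_mx_cst (y u : 'rV[R]_1) (x : 'rV[R]_m) :
  'd (fun s : 'rV[R]_1 => row_mx s x) y u = row_mx u 0.
Proof. exact: (is_diffE u (is_diff_row_mx (is_diff_id y) (is_diff_cst x y))). Qed.

Lemma lift_xiE z : lift_xi z = row_mx (const_mx 1) 0.
Proof.
have e : chart (chart_at z) \o (fun s : real_line R => (s, pi2 z) : L)
    \o chart_inv (chart_at (pi1 z)) =
  fun s : 'rV[R]_1 => row_mx s (chart (chart_at z.2) z.2).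
  apply/funext => s; congr row_mx; apply/rowP => k; rewrite mxE ord1 /=.
  by [].
by rewrite /lift_xi /tmap e; exact: diff_row_mx_cst.
Qed.

Lemma tangent_NE z v : tangent_N z v = row_mx 0 v.
Proof.
pose y := chart (tt : mindex (real_line R)) z.1.
have e : chart (chart_at z) \o (fun q : N => (pi1 z, q) : L)
    \o chart_inv (chart_at (pi2 z)) =
  fun s : 'rV[R]_m => row_mx y ((chart (chart_at z.2) \o chart_inv (chart_at z.2)) s).
  by apply/funext => s.
rewrite /tangent_N /tmap e.
have dt := differentiable_transition (chart_at_dom z.2) (chart_at_dom z.2).
apply: (etrans (is_diffE v (is_diff_row_mx (is_diff_cst y _) (differentiableP dt)))).
by congr row_mx; exact/diff_transition_id/chart_at_dom.
Qed.

(** * The lifted tensors in coordinates: explicit formulas, smoothness, derivatives *)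

Section tensors.
Variables (tau : form1 N) (J : tensor11 N) (g : form2 N) (phi : tensor11 L).

Lemma lift_etaE z v : lift_eta tau z v = lsubmx v 0 0 + tau z.2 (rsubmx v).
Proof. by rewrite /lift_eta dfun_pi1 tmap_pi2. Qed.

Lemma lift_metricE z v w : lift_metric tau g z v w =
  lift_eta tau z v * lift_eta tau z w + g z.2 (rsubmx v) (rsubmx w).
Proof. by rewrite /lift_metric !tmap_pi2. Qed.

Lemma hliftE z v : hlift tau z v = row_mx (const_mx (- tau z.2 v)) v.
Proof.
rewrite /hlift tangent_NE lift_xiE scale_row_mx opp_row_mx add_row_mx.
rewrite scaler0 subr0; congr row_mx; apply/rowP => k.
by rewrite !mxE mulr1 add0r.
Qed.

Lemma lift_tensorE z v : is_lift_tensor tau J phi ->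
  phi z v = row_mx (const_mx (- tau z.2 (J z.2 (rsubmx v)))) (J z.2 (rsubmx v)).
Proof.
move=> [phil phiJ phixi].
(* The splitting of [v] into eta(v) xi and the lift of its component along N; the conditions on
   [phi] give its value on both summands. *)
have -> : v = (lsubmx v 0 0 + tau z.2 (rsubmx v)) *: lift_xi z
    + hlift tau z (rsubmx v).
  rewrite hliftE lift_xiE scale_row_mx add_row_mx scaler0 add0r.
  rewrite -[LHS]hsubmxK; congr row_mx; apply/rowP => k.
  by rewrite !ord1 !mxE mulr1 addrK.
rewrite phil phixi phiJ scaler0 add0r hliftE lift_xiE.
by rewrite hliftE scale_row_mx add_row_mx row_mxKr scaler0 add0r.
Qed.

Hypotheses (htau : is_form1 tau) (hJ : is_tensor11 J) (hg : is_tensor02 g).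
Hypothesis hphi : is_lift_tensor tau J phi.

Lemma local_lift_eta i y w : mcod i (rsubmx y) ->
  local_form1 (lift_eta tau) ((tt, i) : mindex L) y w =
  lsubmx w 0 0 + local_form1 tau i (rsubmx y) (rsubmx w).
Proof.
move=> iy; have iz := chart_inv_dom iy.
by rewrite /local_form1 lift_coord_field // lift_etaE row_mxKl row_mxKr.
Qed.

Lemma local_lift_metric i y v w : mcod i (rsubmx y) ->
  local_form2 (lift_metric tau g) ((tt, i) : mindex L) y v w =
  local_form1 (lift_eta tau) ((tt, i) : mindex L) y v
  * local_form1 (lift_eta tau) ((tt, i) : mindex L) y w
  + local_form2 g i (rsubmx y) (rsubmx v) (rsubmx w).
Proof.
move=> iy; have iz := chart_inv_dom iy.
by rewrite /local_form2 /local_form1 lift_metricE !lift_coord_field // !row_mxKr.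
Qed.

Lemma local_lift_tensor i y w : mcod i (rsubmx y) ->
  local_tensor11 phi ((tt, i) : mindex L) y w =
  row_mx (const_mx (- local_form1 tau i (rsubmx y)
                        (local_tensor11 J i (rsubmx y) (rsubmx w))))
         (local_tensor11 J i (rsubmx y) (rsubmx w)).
Proof.
move=> iy; have iz := chart_inv_dom iy.
rewrite /local_tensor11 lift_coord_field // (lift_tensorE _ _ hphi).
rewrite lift_chart_vec // row_mxKl !row_mxKr.
by rewrite /local_form1 chart_vecK.
Qed.

Lemma near_mcod_lift i (y : 'rV[R]_(1 + m)) : mcod i (rsubmx y) ->
  \forall x \near y, mcod i (rsubmx x).
Proof.
move=> iy; have oD : open [set x : 'rV[R]_(1 + m) | mcod i (rsubmx x)].
  by apply: (open_comp _ (@mcod_open _ _ N i)) => x _; exact: continuous_rsubmx.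
exact: (open_nbhs_nbhs (conj oD iy)).
Qed.

(** The coefficients of the lifted tensors do not depend on t, so each one is a function on a chart
    of N composed with [rsubmx]. *)
Lemma smooth_on_mcod_lift (W : normedModType R) (f : 'rV[R]_m -> W) i :
  smooth_on (mcod i) f -> smooth_on (mcod ((tt, i) : mindex L)) (f \o rsubmx).
Proof.
move=> sf; apply: sub_smooth_on (smooth_on_comp_rsubmx (@mcod_open _ _ N i) sf).
by move=> y [].
Qed.

Lemma lift_eta_scalar z : scalar (lift_eta tau z).
Proof.
have [tl _] := htau.
by move=> a u v; rewrite !lift_etaE !linearP /= tl !mxE; ring.
Qed.

Lemma smooth_local_lift_eta i w : smooth_on (mcod ((tt, i) : mindex L))
  (local_form1 (lift_eta tau) ((tt, i) : mindex L) ^~ w).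
Proof.
apply: (eq_on_smooth_on (f := fun y => cst (lsubmx w 0 0) y
    + ((local_form1 tau i ^~ (rsubmx w)) \o rsubmx) y)).
- exact: mcod_open.
- by move=> y [_ iy]; rewrite local_lift_eta.
apply: smooth_on_add; first exact: mcod_open.
  exact: smooth_on_cst.
by apply: smooth_on_mcod_lift; exact: is_form1_local.
Qed.

Lemma lift_eta_is_form1 : is_form1 (lift_eta tau).
Proof.
apply: local_is_form1; first exact: lift_eta_scalar.
by move=> [[] i] w; exact: smooth_local_lift_eta.
Qed.

Lemma lift_metric_is_tensor02 : is_tensor02 (lift_metric tau g).
Proof.
have [g1 g2 _] := hg.
apply: local_is_tensor02.
- move=> z v a u w; rewrite !lift_metricE lift_eta_scalar linearP g1 /=; ring.
- move=> z v a u w; rewrite !lift_metricE lift_eta_scalar linearP g2 /=; ring.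
move=> [[] i] v w.
(* The product of the two values of eta is written as a scaling, to which [smooth_on_scale]
   applies. *)
apply: (eq_on_smooth_on (f := fun y =>
    local_form1 (lift_eta tau) ((tt, i) : mindex L) y v
    *: local_form1 (lift_eta tau) ((tt, i) : mindex L) y w
    + ((fun x => local_form2 g i x (rsubmx v) (rsubmx w)) \o rsubmx) y)).
- exact: mcod_open.
- by move=> y [_ iy]; rewrite local_lift_metric.
apply: smooth_on_add; first exact: mcod_open.
  by apply: smooth_on_scale; [exact: mcod_open|
    exact: smooth_local_lift_eta|exact: smooth_local_lift_eta].
by apply: smooth_on_mcod_lift; exact: is_tensor02_local.
Qed.

Lemma smooth_local_form1_tensor i w : smooth_on (mcod i)
  (fun x => local_form1 tau i x (local_tensor11 J i x w)).
Proof.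
apply: smooth_on_apply.
- exact: mcod_open.
- by move=> y; apply: local_form1_is_linear; case: htau.
- by move=> v; exact: is_form1_local.
- exact: is_tensor11_local.
Qed.

Lemma lift_tensor_is_tensor11 : is_tensor11 phi.
Proof.
have [phil _ _] := hphi.
apply: local_is_tensor11 => // -[[] i] w.
(* The t component is written as a scalar times the constant row 1, again for [smooth_on_scale]. *)
apply: (eq_on_smooth_on (f := (fun x => row_mx
  (- local_form1 tau i x (local_tensor11 J i x (rsubmx w)) *: (const_mx 1 : 'rV[R]_1))
  (local_tensor11 J i x (rsubmx w))) \o rsubmx)).
- exact: mcod_open.
- move=> y [_ iy]; rewrite local_lift_tensor //=; congr row_mx.
  by apply/rowP => k; rewrite !mxE mulr1.
apply: smooth_on_mcod_lift; apply: smooth_on_row_pair.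
- exact: mcod_open.
- apply: smooth_on_scale; [exact: mcod_open| |exact: smooth_on_cst].
  apply: (eq_on_smooth_on (f := fun x => cst (- 1 : R) x
      *: local_form1 tau i x (local_tensor11 J i x (rsubmx w)))).
  + exact: mcod_open.
  + by move=> x _; rewrite scaleN1r.
  + by apply: smooth_on_scale; [exact: mcod_open|exact: smooth_on_cst|
      exact: smooth_local_form1_tensor].
- exact: is_tensor11_local.
Qed.

(** The coefficient of dt is constant, so only [tau] contributes. *)
Lemma diff_local_lift_eta i y w v : mcod i (rsubmx y) ->
  'd (local_form1 (lift_eta tau) ((tt, i) : mindex L) ^~ w) y v =
  'd (local_form1 tau i ^~ (rsubmx w)) (rsubmx y) (rsubmx v).
Proof.
move=> iy.
have dt := smooth_on_differentiable (x := rsubmx y)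
  (@is_form1_local _ _ _ _ i (rsubmx w) htau) iy.
have h := is_diffD (is_diff_cst (lsubmx w 0 0) y) (is_diff_comp_rsubmx dt).
have [dh _] := h.
have e : \forall x \near y, (cst (lsubmx w 0 0)
    + (local_form1 tau i ^~ (rsubmx w)) \o rsubmx) x =
    local_form1 (lift_eta tau) ((tt, i) : mindex L) x w.
  move: (near_mcod_lift iy); apply: filterS => x ix.
  by rewrite local_lift_eta.
rewrite (near_eq_diff v e dh) (is_diffE v h).
exact: add0r.
Qed.

Lemma diff_local_lift_tensor i y w v : mcod i (rsubmx y) ->
  let x := rsubmx y in
  let dJ := 'd (local_tensor11 J i ^~ (rsubmx w)) x (rsubmx v) in
  'd (local_tensor11 phi ((tt, i) : mindex L) ^~ w) y v =
  row_mx (const_mx (- ('d (local_form1 tau i ^~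
      (local_tensor11 J i x (rsubmx w))) x (rsubmx v)
      + local_form1 tau i x dJ))) dJ.
Proof.
move=> iy x dJ; have [tl _] := htau.
have dt u := smooth_on_differentiable (x := x)
  (@is_form1_local _ _ _ _ i u htau) iy.
have djx := smooth_on_differentiable (x := x)
  (@is_tensor11_local _ _ _ _ i (rsubmx w) hJ) iy.
(* Product rule for T_x(J_x w'), where both the coefficients of [tau] and the vector they act on
   vary with x. *)
have h1 := is_diff_apply (fun y => @local_form1_is_linear _ _ _ tau i y tl) dt
  (differentiableP djx).
have h2 := is_diff_scale (is_diffN h1) (is_diff_cst (const_mx 1 : 'rV[R]_1) x).
have h3 := is_diff_row_mx h2 (differentiableP djx).
have [d3 _] := h3.
have h4 := is_diff_comp_rsubmx d3.
have [d4 _] := h4.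
apply: (etrans (y := 'd _ y v) (near_eq_diff v _ d4)).
  move: (near_mcod_lift iy); apply: filterS => s ix.
  rewrite local_lift_tensor //=; congr row_mx.
  by apply/rowP => k; rewrite !mxE mulr1.
rewrite (is_diffE v h4) (is_diffE _ h3); congr row_mx.
by apply/rowP => k; rewrite !mxE mulr1 mulr0 add0r.
Qed.

Lemma smooth_lift_xi : smooth_vfield setT (@lift_xi R m N).
Proof.
move=> [[] i]; apply: (eq_on_smooth_on (f := cst (row_mx (const_mx 1) 0))).
- by apply: open_chart_preimage; exact: openT.
- move=> y [[_ iy] _]; have iz := chart_inv_dom iy.
  rewrite /chart_field lift_xiE lift_chart_vec // row_mxKl row_mxKr.
  by rewrite /chart_vec linear0.
exact: smooth_on_cst.
Qed.

Lemma lift_eta_xi z : lift_eta tau z (lift_xi z) = 1.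
Proof. by rewrite lift_etaE lift_xiE row_mxKl row_mxKr mxE form1_0 // addr0. Qed.

Lemma lift_eta_tensor z v : lift_eta tau z (phi z v) = 0.
Proof. by rewrite lift_etaE (lift_tensorE _ _ hphi) row_mxKl row_mxKr mxE addNr. Qed.

Lemma lift_metric_is_riemannian :
  is_riemannian g -> is_riemannian (lift_metric tau g).
Proof.
move=> [_ gC gp]; split; first exact: lift_metric_is_tensor02.
  by move=> z v w; rewrite !lift_metricE gC mulrC.
move=> z v v0; rewrite lift_metricE -expr2.
(* If the component along N is nonzero, [g] is positive on it and the square of eta is nonnegative.
   Otherwise eta(v) is the t component of [v], which cannot vanish. *)
have [v2|v2] := eqVneq (rsubmx v) 0; last first.
  by rewrite ltr_wpDl ?sqr_ge0 // gp.
have g0 : g z.2 0 0 = 0.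
  by have [_ gl' _] := hg; have := gl' z.2 0 (-1) 0 0; rewrite scaler0 addr0 mulN1r addNr.
rewrite v2 g0 addr0 exprn_even_gt0 //= lift_etaE v2 form1_0 // addr0.
apply: contra_neq v0 => v1; rewrite -(hsubmxK v) v2 -[RHS]row_mx0; congr row_mx.
by apply/rowP => k; rewrite ord1 v1 mxE.
Qed.

End tensors.

(** * The contact metric and normality conditions *)

Section sasakian.
Variables (tau : form1 N) (J : tensor11 N) (g : form2 N) (phi : tensor11 L).
Hypotheses (hK : is_kahler J g) (htau : is_form1 tau).
Hypothesis hd : fields2 (fun (X Y : vfield N) (p : N) =>
  fundamental_form J g p (X p) (Y p) = ext_d1 tau X Y p).
Hypothesis hphi : is_lift_tensor tau J phi.

Let hJ : is_tensor11 J. Proof. by case: hK. Qed.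
Let hg : is_riemannian g. Proof. by case: hK. Qed.
Let hg2 : is_tensor02 g. Proof. by case: hg. Qed.

Lemma lift_almost_contact_metric : almost_contact_metric phi
  (@lift_xi R m N) (lift_eta tau) (lift_metric tau g).
Proof.
split.
- exact: lift_tensor_is_tensor11 htau hJ hphi.
- exact: smooth_lift_xi.
- exact: lift_eta_is_form1.
- exact: lift_metric_is_riemannian htau hg2 hg.
(* Both sides have components (T(v'), - v'): on the left since J^2 = -1, on the right since the t
   component of [v] cancels. *)
- move=> z v; rewrite !(lift_tensorE _ _ hphi) row_mxKr (kahler_JJ hK).
  rewrite (form1N _ _ htau) opprK.
  rewrite lift_xiE lift_etaE -[in - v](hsubmxK v) scale_row_mx opp_row_mx.
  rewrite add_row_mx scaler0 addr0; congr row_mx; apply/rowP => k.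
  by rewrite ord1 !mxE; ring.
- exact: lift_eta_xi.
- move=> z v w; rewrite !lift_metricE !(lift_eta_tensor hphi) mul0r add0r.
  rewrite !(lift_tensorE _ _ hphi) !row_mxKr (kahler_gJ hK); ring.
Qed.

(* This is omega = dtau on coordinate fields, whose bracket vanishes. *)
Lemma kahler_form_local q v w : g q v (J q w) =
  2^-1 * ('d (local_form1 tau (chart_at q) ^~ w) (chart (chart_at q) q) v
          - 'd (local_form1 tau (chart_at q) ^~ v) (chart (chart_at q) q) w).
Proof.
have oq := @mdom_open _ _ N (chart_at q).
have dq := chart_at_dom q.
have sv := @smooth_coord_field _ _ _ (chart_at q) v.
have sw := @smooth_coord_field _ _ _ (chart_at q) w.
have := hd oq sv sw dq.
by rewrite (ext_d1_local oq dq htau sv sw) /fundamental_form !coord_field_at.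
Qed.

(** Integrability tested on the coordinate fields that take the values [v] and [w] at [q]. *)
Lemma nijenhuis_tensor_local q v w :
  let D u := 'd (local_tensor11 J (chart_at q) ^~ u) (chart (chart_at q) q) in
  D w (J q v) - D v (J q w) + J q (D v w - D w v) = 0.
Proof.
have oq := @mdom_open _ _ N (chart_at q).
have dq := chart_at_dom q.
have sv := @smooth_coord_field _ _ _ (chart_at q) v.
have sw := @smooth_coord_field _ _ _ (chart_at q) w.
have := kahler_integrable hK oq sv sw dq.
by rewrite (nijenhuis_local oq dq hJ sv sw) !coord_field_at.
Qed.

Lemma ext_d1_lift_eta U X Y z : open U -> smooth_vfield U X ->
  smooth_vfield U Y -> U z ->
  ext_d1 (lift_eta tau) X Y z = g z.2 (rsubmx (X z)) (J z.2 (rsubmx (Y z))).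
Proof.
move=> oU sX sY Uz.
have iz : mcod (chart_at z.2) (rsubmx (chart (chart_at z) z)).
  by rewrite rsubmx_chart; exact/chart_cod/chart_at_dom.
rewrite (ext_d1_local oU Uz (lift_eta_is_form1 htau) sX sY) kahler_form_local.
by rewrite !(diff_local_lift_eta htau _ _ iz) rsubmx_chart.
Qed.

Lemma lift_contact_metric : contact_metric phi
  (@lift_xi R m N) (lift_eta tau) (lift_metric tau g).
Proof.
split; first exact: lift_almost_contact_metric.
move=> U X Y oU sX sY z Uz; rewrite (ext_d1_lift_eta oU) //.
rewrite /fundamental_form lift_metricE (lift_eta_tensor hphi) mulr0 add0r.
by rewrite (lift_tensorE _ _ hphi) row_mxKr.
Qed.

(** The derivative along [v] of the coefficients of [phi] at the fixed vector [w], with the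
    derivatives of [tau] and [J] abstracted as [t] and [D]; in these the direction is the last
    argument. This reduces normality to linear algebra. *)
Let dphi q (t : 'rV[R]_m -> 'rV[R]_m -> R) (D : 'rV[R]_m -> 'rV[R]_m -> 'rV[R]_m)
    (v w : 'rV[R]_m) : 'rV[R]_(1 + m) :=
  row_mx (const_mx (- (t (J q w) v + tau q (D w v)))) (D w v).

Let dtau q w := 'd (local_form1 tau (chart_at q) ^~ w) (chart (chart_at q) q).
Let dJ q w := 'd (local_tensor11 J (chart_at q) ^~ w) (chart (chart_at q) q).

Lemma diff_local_lift_tensor_at z v w :
  'd (local_tensor11 phi (chart_at z) ^~ w) (chart (chart_at z) z) v =
  dphi z.2 (dtau z.2) (dJ z.2) (rsubmx v) (rsubmx w).
Proof.
have iz : mcod (chart_at z.2) (rsubmx (chart (chart_at z) z)).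
  by rewrite rsubmx_chart; exact/chart_cod/chart_at_dom.
have := diff_local_lift_tensor htau hJ hphi w v iz; cbv zeta.
by rewrite rsubmx_chart local_tensor11_at local_form1_at.
Qed.

(** The first hypothesis is the vanishing of the Nijenhuis tensor of [J]; the second is omega(Ja,
    Jb) = omega(a, b), up to the factor 2. The component along N is the first one; in the t
    component the [tau] terms form [tau] of that same tensor, and the [t] terms cancel by the
    second. *)
Lemma lift_normality_identity q t D a b :
  D b (J q a) - D a (J q b) + J q (D a b - D b a) = 0 ->
  t (J q b) (J q a) - t (J q a) (J q b) = t b a - t a b ->
  let e := rsubmx (dphi q t D b a - dphi q t D a b) in
  dphi q t D (J q a) b - dphi q t D (J q b) a
    + row_mx (const_mx (- tau q (J q e))) (J q e)
    + (t b a - t a b) *: row_mx (const_mx 1) 0 = 0.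
Proof.
move=> hN hw e.
have -> : e = D a b - D b a by rewrite /e linearB /= !row_mxKr.
rewrite /dphi scale_row_mx !opp_row_mx !add_row_mx scaler0 addr0 hN.
rewrite -[RHS]row_mx0; congr row_mx; apply/rowP => k; rewrite !mxE.
(* Applying [tau] to the vanishing Nijenhuis expression gives the relation that removes all [tau]
   terms. *)
have := form1_0 q htau; rewrite -hN !(form1D _ _ _ htau) (form1N _ _ htau) => hN1.
rewrite -hw; move: hN1.
move: (tau q (J q _)) (tau q (D b _)) (tau q (D a _)) => x y u.
by move=> h; rewrite (_ : x = u - y); [ring|rewrite -[LHS]subr0 -h; ring].
Qed.

Lemma lift_normal_structure : normal_structure phi
  (@lift_xi R m N) (lift_eta tau).
Proof.
move=> U X Y oU sX sY z Uz; rewrite (ext_d1_lift_eta oU) //.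
have hP := lift_tensor_is_tensor11 htau hJ hphi.
have nE d1 d2 d3 d4 :
    'd (local_tensor11 phi (chart_at z) ^~ (Y z)) (chart (chart_at z) z)
      (phi z (X z)) = d1 ->
    'd (local_tensor11 phi (chart_at z) ^~ (X z)) (chart (chart_at z) z)
      (phi z (Y z)) = d2 ->
    'd (local_tensor11 phi (chart_at z) ^~ (X z)) (chart (chart_at z) z)
      (Y z) = d3 ->
    'd (local_tensor11 phi (chart_at z) ^~ (Y z)) (chart (chart_at z) z)
      (X z) = d4 ->
    nijenhuis phi X Y z = d1 - d2 + phi z (d3 - d4).
  by move=> <- <- <- <-; exact: (nijenhuis_local oU Uz hP sX sY).
have phiN v : rsubmx (phi z v) = J z.2 (rsubmx v).
  by rewrite (lift_tensorE _ _ hphi) row_mxKr.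
rewrite (nE _ _ _ _ (diff_local_lift_tensor_at _ _ _)
  (diff_local_lift_tensor_at _ _ _) (diff_local_lift_tensor_at _ _ _)
  (diff_local_lift_tensor_at _ _ _)) {nE}.
rewrite !phiN (lift_tensorE _ _ hphi) lift_xiE.
set a := rsubmx (X z); set b := rsubmx (Y z).
(* The factor 2 in the normality condition cancels the 1/2 in [ext_d1]. *)
have w2 v w : 2 * g z.2 v (J z.2 w) = dtau z.2 w v - dtau z.2 v w.
  by rewrite kahler_form_local mulrA divff ?mul1r // pnatr_eq0.
rewrite w2; apply: lift_normality_identity.
  exact: nijenhuis_tensor_local.
(* Since [g] is Hermitian, g(Ja, J(Jb)) = g(a, Jb), which is the invariance of omega under [J]. *)
by rewrite -!w2 (kahler_gJ hK).
Qed.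

End sasakian.

End lift_space.

Theorem proposition2 (R : realType) (n : nat) (N : manifold R (2 * n))
    (J : tensor11 N) (g : form2 N) (tau : form1 N) (phi : tensor11 (lift_space N))
    (hK : is_kahler J g) (htau : is_form1 tau)
    (hd : fields2 (fun (X Y : vfield N) (p : N) =>
            fundamental_form J g p (X p) (Y p) = ext_d1 tau X Y p))
    (hphi : is_lift_tensor tau J phi) :
  sasakian phi (@lift_xi R (2 * n) N) (lift_eta tau) (lift_metric tau g).
Proof.
split; first exact: lift_contact_metric hK htau hd hphi.
exact: lift_normal_structure hK htau hd hphi.
Qed.
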